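(* Let $n\ge 1$ and $H\ge 0$ be integers. For every ordered tree with $n+1$ nodes and height $H+1$, let $x_i$ be its number of nodes of depth $i$ and let $R^{H+1}$ be the integer vector constructed from the tree as described in the context. Then the vector $R^{H+1}$ represents an $n$-element semiorder of length $H$ with exactly $x_{H+1}$ good elements. Moreover, sending a tree to the semiorder represented by $R^{H+1}$ gives a bijective map from the $(n+1)$-node ordered trees of height $H+1$ to the $n$-element semiorders of length $H$ (up to isomorphism).
   Context: All posets are finite. A semiorder is a poset with no induced subposet isomorphic to $\mathbf{2}+\mathbf{2}$ (disjoint union of two 2-element chains with no other comparabilities) or $\mathbf{3}+\mathbf{1}$ (disjoint union of a 3-element chain and a single incomparable element). Its length is the length of a longest chain (a chain with $\ell+1$ elements has length $\ell$). Every $n$-element semiorder $R$ is, up to isomorphism, uniquely represented by an integer vector $\rho(R)=(r_1,\dots,r_n)$, where $r_i$ is the number of elements smaller than the $i$-th element (elements suitably indexed), $r_1\ge r_2\ge\dots\ge r_n\ge 0$ and $r_i\le n-i$ for all $i$. Such a vector represents the semiorder on elements $1,\dots,n$ in which element $i$ is greater than element $j$ if and only if $j\ge n-r_i+1$. An element $a$ of a semiorder is on the $i$-th level ($i\ge1$) if $i$ is the largest integer for which there exist $i-1$ elements with $a_1>a_2>\dots>a_{i-1}>a$. An element is good if it is on the last level (level $H+1$ for a semiorder of length $H$). An ordered tree is a rooted tree embedded in the plane so that the relative order of the subtrees at each node is part of its structure. The depth of a node is its distance to the root, and the height is the maximal depth. Construction of $R^{H+1}$. Given an ordered tree with $n+1$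 nodes and height $H+1$, let $x_i$ be the number of nodes of depth $i$ ($0\le i\le H+1$, $x_0=1$). The nodes of each depth are ordered from left to right. For $1\le i\le H+1$ and $1\le j\le x_{i-1}$, let $s^i_j$ be the number of nodes of depth $i$ adjacent to the $j$-th node of depth $i-1$, and let $u^i_j=\sum_{k=j}^{x_{i-1}} s^i_k$. Let $y_0=0$ and $y_i=\sum_{k=1}^i x_k$ (so $y_{H+1}=n$). Set $R^1=(0,\dots,0)$ with $x_1=y_1$ zeros. For $1\le i\le H$, if $R^i=(r^i_1,\dots,r^i_{y_i})$, let $$R^{i+1}=\bigl(r_1^i+x_{i+1},\dots,r_{y_{i-1}}^i+x_{i+1},\ r^i_{y_{i-1}+1}+u^{i+1}_1,\dots,r^i_{y_{i-1}+x_i}+u^{i+1}_{x_i},\ 0,\dots,0\bigr),$$ with $x_{i+1}$ zeros at the end, so that $R^{i+1}$ has $y_{i+1}$ entries. *)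

(* Defs.v *)
From HB Require Import structures.
From mathcomp Require Import all_boot all_order.

Set Implicit Arguments.
Unset Strict Implicit.
Unset Printing Implicit Defensive.

(* The disjoint union of a p-element chain and a q-element chain, as a        *)
(* (non-strict) order relation.                                               *)
Definition chain_sum (p q : nat) (u v : 'I_p + 'I_q) : bool :=
  match u, v with
  | inl i, inl j => i <= j
  | inr i, inr j => i <= j
  | _, _ => false
  end.

(* Injectivity of f follows from the equivalence, by antisymmetry.            *)
Definition has_induced_chain_sum (d : Order.disp_t) (P : finPOrderType d)
    (p q : nat) : Prop :=
  exists f : 'I_p + 'I_q -> P,
    forall u v, (f u <= f v)%O = chain_sum u v.

Definition is_semiorder (d : Order.disp_t) (P : finPOrderType d) : Prop :=
  ~ has_induced_chain_sum P 2 2 /\ ~ has_induced_chain_sum P 3 1.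

Definition poset_iso (d d' : Order.disp_t) (P : finPOrderType d)
    (Q : finPOrderType d') : Prop :=
  exists2 f : P -> Q, bijective f & {mono f : x y / (x <= y)%O}.

Definition is_chain (d : Order.disp_t) (P : finPOrderType d) (A : {set P}) :=
  [forall x in A, forall y in A, (x >=< y)%O].

Definition poset_length (d : Order.disp_t) (P : finPOrderType d) : nat :=
  \max_(A : {set P} | is_chain A) #|A|.-1.

(* Levels are numbered from 1: a is on level k + 1 for the largest k such     *)
(* that a_1 > ... > a_k > a for some a_1, ..., a_k.  The bound k < #|P| loses *)
(* nothing, because a_1, ..., a_k, a are distinct.                            *)
Definition level (d : Order.disp_t) (P : finPOrderType d) (a : P) : nat :=
  \max_(k < #|P| | [exists s : k.-tuple P, sorted >%O (rcons s a)]) k.+1.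

Definition good (d : Order.disp_t) (P : finPOrderType d) : {set P} :=
  [set a | level a == (poset_length P).+1].

(* r_i <= n - i for 1 <= i <= n; r_i is nth 0 r i.-1.                         *)
Definition is_svec (n : nat) (r : seq nat) : bool :=
  [&& size r == n, sorted geq r & [forall i : 'I_n, nth 0 r i <= n - i.+1]].

Record svec (n : nat) : Type :=
  SVec { svec_seq :> seq nat; svecP : is_svec n svec_seq }.

Definition semiorder_of (n : nat) (r : svec n) : Type := 'I_n.

HB.instance Definition _ (n : nat) (r : svec n) :=
  Finite.copy (semiorder_of r) 'I_n.

Section SemiorderOf.
Variables (n : nat) (r : svec n).
Implicit Types i j k : semiorder_of r.

(* With elements numbered from 1, i > j iff j >= n - r_i + 1; the ordinals of *)
(* 'I_n are numbered from 0, which cancels the "+ 1".                         *)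
Definition svec_lt j i : bool := n - nth 0 r (i : 'I_n) <= (j : 'I_n).

Definition svec_le j i : bool := (j == i) || svec_lt j i.

Lemma svec_lt_ltn j i : svec_lt j i -> (i : 'I_n) < (j : 'I_n).
Proof.
rewrite /svec_lt => /(leq_trans _); apply.
have /and3P[_ _ /forallP/(_ i) ri] := svecP r.
have lt_in : (i : 'I_n) < n := ltn_ord i.
by rewrite leq_subRL ?(leq_trans ri) ?leq_subr// addnC -leq_subRL.
Qed.

Lemma svec_lt_trans j i k : svec_lt i j -> svec_lt j k -> svec_lt i k.
Proof.
move=> ij jk; apply: leq_trans ij; apply: leq_sub2l.
have /and3P[/eqP sz r_sorted _] := svecP r.
have geq_trans : transitive geq by move=> a b c ba ac; apply: leq_trans ac ba.
apply: (sorted_leq_nth geq_trans leqnn 0 r_sorted);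
  by [rewrite inE sz ltn_ord | apply: ltnW; apply: svec_lt_ltn].
Qed.

Lemma svec_le_refl : reflexive svec_le.
Proof. by move=> i; rewrite /svec_le eqxx. Qed.

Lemma svec_le_anti : antisymmetric svec_le.
Proof.
move=> i j /andP[/orP[/eqP//|ij] /orP[/eqP//|ji]].
by have := ltn_trans (svec_lt_ltn ij) (svec_lt_ltn ji); rewrite ltnn.
Qed.

Lemma svec_le_trans : transitive svec_le.
Proof.
move=> j i k /orP[/eqP->//|ij] /orP[/eqP<-|jk]; first by rewrite /svec_le ij orbT.
by rewrite /svec_le (svec_lt_trans ij jk) orbT.
Qed.

End SemiorderOf.

Fact svec_display : Order.disp_t. Proof. exact: Order.Disp tt tt. Qed.

HB.instance Definition _ (n : nat) (r : svec n) :=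
  Order.Le_isPOrder.Build svec_display (semiorder_of r)
    (@svec_le_refl n r) (@svec_le_anti n r) (@svec_le_trans n r).

(* A node is the list of the subtrees rooted at its children, from left to    *)
(* right.                                                                     *)
Inductive otree : Type := ONode of seq otree.

Definition children (t : otree) : seq otree := let: ONode ts := t in ts.

Fixpoint num_nodes (t : otree) : nat :=
  let: ONode ts := t in (sumn [seq num_nodes u | u <- ts]).+1.

Fixpoint height (t : otree) : nat :=
  let: ONode ts := t in foldr maxn 0 [seq (height u).+1 | u <- ts].

Definition otree_of (n H : nat) : Type :=
  {t : otree | (num_nodes t == n.+1) && (height t == H.+1)}.

(* Each node of depth i is given by the subtree rooted at it; the list goes   *)
(* from left to right.                                                        *)
Fixpoint nodes_at (t : otree) (i : nat) : seq otree :=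
  if i is i'.+1 then flatten [seq children u | u <- nodes_at t i'] else [:: t].

Section Construction.
Variable t : otree.

Definition tree_x (i : nat) : nat := size (nodes_at t i).

(* s^i_j, where 1 <= i and 1 <= j <= x_{i-1}.                                 *)
Definition tree_s (i j : nat) : nat :=
  size (children (nth (ONode [::]) (nodes_at t i.-1) j.-1)).

Definition tree_u (i j : nat) : nat :=
  \sum_(j <= k < (tree_x i.-1).+1) tree_s i k.

Definition tree_y (i : nat) : nat := \sum_(1 <= k < i.+1) tree_x k.

(* R^{i+1} from R^i = r, where 1 <= i.                                        *)
Definition tree_R_step (i : nat) (r : seq nat) : seq nat :=
  [seq nth 0 r k.-1 + tree_x i.+1 | k <- iota 1 (tree_y i.-1)] ++
  [seq nth 0 r (tree_y i.-1 + j).-1 + tree_u i.+1 j | j <- iota 1 (tree_x i)] ++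
  nseq (tree_x i.+1) 0.

(* tree_R h is R^{h+1}.                                                       *)
Fixpoint tree_R (h : nat) : seq nat :=
  if h is h'.+1 then tree_R_step h (tree_R h') else nseq (tree_x 1) 0.

End Construction.

(* Main.v *)
Require Import Defs.
From mathcomp Require Import all_boot all_order.
From mathcomp Require Import zify.

(* Number the elements from 0 and put c_p = n - r_p. Then j < i in the        *)
(* semiorder iff c_i <= j, and its levels are the intervals [y_k, y_{k+1})    *)
(* with y_0 = 0 and y_{k+1} = c_{y_k}. For the vector built from a tree, c_p  *)
(* is the total number of children of the root and of the first p other       *)
(* nodes in breadth-first order, so the y_k are those of the tree, and the    *)
(* vector amounts to the breadth-first sequence of node degrees, from which   *)
(* the tree is rebuilt level by level, starting from the deepest one.         *)
(* On the order side, r is the sorted list of the sizes of the strict         *)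
(* down-sets, hence an isomorphism invariant. Conversely, in a semiorder the  *)
(* down-sets are nested, and so are the up-sets, in a compatible way; listing *)
(* the elements accordingly makes every down-set a final segment.             *)

Set Implicit Arguments.
Unset Strict Implicit.
Unset Printing Implicit Defensive.

Import Order.TTheory.

(** A vector and a tree carry the same prefix sums. [tree_RE] solves the recursion for the vector,
    and [tree_cut] reads off that its cuts are the prefix sums of the breadth-first degrees. By
    [tree_front] the levels of the tree and of the semiorder then have the same sizes, so the length
    and the number of good elements come from [svec_poset_length] and [svec_card_good]. Injectivity
    combines [svec_iso_eq] (the vector is an isomorphism invariant) with [tree_R_inj] (the vector
    determines the tree). Surjectivity combines [semiorder_svec] (every semiorder has a vector) with
    [tree_of_svec] (every vector whose fronts first reach [n] at step [H.+1] has a tree). *)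

(** * Final segments of ordinals and prefix sums *)

Lemma card_ord_geq (n m : nat) : #|[set k : 'I_n | m <= k]| = n - m.
Proof.
rewrite cardsE -sum1_card (eq_bigl (fun k : 'I_n => (m <= k))) //.
rewrite -(big_mkord (fun k => m <= k) (fun=> 1)).
case: (leqP m n) => [le_mn | lt_nm].
  rewrite -[RHS]muln1 -sum_nat_const_nat (big_cat_nat _ le_mn) //=.
  rewrite big_nat_cond big1 ?add0n; last by move=> i; lia.
  by rewrite [RHS]big_nat_cond [LHS]big_nat_cond; apply: eq_bigl => i; lia.
by rewrite big_nat_cond big1 => [|i]; lia.
Qed.

(** An up-closed set of ordinals is a final segment, so its size determines it. This is how a
    down-set becomes a single entry of the vector. *)
Lemma mem_up_closed (n : nat) (A : {set 'I_n}) :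
  (forall i k : 'I_n, i \in A -> i <= k -> k \in A) ->
  forall i, (i \in A) = (n - #|A| <= i).
Proof.
move=> upA i; apply/idP/idP => [iA|].
  suff : n - i <= #|A| by lia.
  rewrite -card_ord_geq; apply/subset_leq_card/subsetP => k.
  by rewrite inE => /(upA _ _ iA).
apply: contraTT => iNA; rewrite -ltnNge.
suff : #|A| <= n - i.+1 by have := ltn_ord i; lia.
rewrite -card_ord_geq; apply/subset_leq_card/subsetP => k kA.
by rewrite inE ltnNge; apply: contra iNA; apply: upA.
Qed.

Lemma eq_sumn_take (s s' : seq nat) :
  size s = size s' ->
  (forall p, p < size s -> sumn (take p.+1 s) = sumn (take p.+1 s')) -> s = s'.
Proof.
elim: s s' => [|a s IHs] [|b s'] //= [eq_sz] eq_sums.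
have ab : a = b by have := eq_sums 0 isT; rewrite !take0 /=; lia.
congr cons => //; apply: IHs => // p lt_ps.
by have := eq_sums p.+1 lt_ps => /=; lia.
Qed.

Lemma sumn_drop_nth (s : seq nat) q :
  sumn (drop q s) = \sum_(q <= k < size s) nth 0 s k.
Proof.
rewrite sumnE (big_nth 0) size_drop -[in RHS](add0n q) big_addn.
by apply: eq_bigr => k _; rewrite nth_drop addnC.
Qed.

Lemma geq_trans : transitive geq.
Proof. by move=> a b c ba ac; apply: leq_trans ac ba. Qed.

(** * Cuts and fronts of a vector *)

Section Cut.
Variables (n : nat) (r : seq nat).

Definition cut p := n - nth 0 r p.
Definition front i := iter i cut 0.

Hypothesis r_svec : is_svec n r.

Lemma svec_size : size r = n.
Proof. by case/and3P: r_svec => /eqP. Qed.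

Lemma svec_nth_leq p : nth 0 r p <= n - p.+1.
Proof.
case/and3P: r_svec => /eqP sz _ /forallP rP.
case: (ltnP p n) => [lt_pn | le_np]; first exact: rP (Ordinal lt_pn).
by rewrite nth_default ?sz.
Qed.

Lemma leq_cut p q : p <= q -> cut p <= cut q.
Proof.
move=> le_pq; case/and3P: (r_svec) => /eqP sz r_sorted _.
apply: leq_sub2l; case: (ltnP q n) => [lt_qn | le_nq]; last first.
  by rewrite nth_default ?sz.
by apply: (sorted_leq_nth geq_trans leqnn 0 r_sorted); rewrite ?inE ?sz; lia.
Qed.

Lemma ltn_cut p : p < n -> p < cut p.
Proof. by rewrite /cut; have := svec_nth_leq p; lia. Qed.

Lemma cut_leq p : cut p <= n.
Proof. exact: leq_subr. Qed.

(** Past the end [nth] returns 0, so [n] is a fixed point of [cut] and the fronts stay at [n] once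
    they reach it. *)
Lemma cut_default p : n <= p -> cut p = n.
Proof. by move=> le_np; rewrite /cut nth_default ?subn0 ?svec_size. Qed.

Lemma frontS i : front i.+1 = cut (front i). Proof. by []. Qed.

Lemma front_leq i : front i <= n.
Proof. by case: i => // i; rewrite frontS cut_leq. Qed.

Lemma front_leqS i : front i <= front i.+1.
Proof.
rewrite frontS; case: (ltnP (front i) n) => [/ltn_cut/ltnW // | le_n].
by rewrite cut_default ?front_leq.
Qed.

Lemma leq_front i j : i <= j -> front i <= front j.
Proof. by move/(@homo_leq _ front _ leqnn leq_trans front_leqS). Qed.

Lemma ltn_front i j : front i < n -> i < j -> front i < front j.
Proof.
by move=> /ltn_cut lt_i /leq_front; apply: leq_trans; rewrite frontS.
Qed.

Lemma front_block m a : a < front m ->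
  exists2 k, k < m & front k <= a < front k.+1.
Proof.
elim: m => // m IHm lt_a; case: (ltnP a (front m)) => [/IHm[k lt_km ka]|le_a].
  by exists k => //; apply: ltnW.
by exists m; rewrite ?le_a.
Qed.

(** Each step moves the front by at least one until it reaches [n]. *)
Lemma geq_minn_front i : minn i n <= front i.
Proof.
elim: i => [|i IHi]; first by rewrite min0n.
case: (ltnP (front i) n) => [/ltn_cut | /cut_default eq_n].
  by rewrite -frontS; lia.
by rewrite frontS eq_n geq_minr.
Qed.

Lemma front_reach : 0 < n -> exists2 H, front H < n & front H.+1 = n.
Proof.
move=> n_gt0.
have: exists i, front i == n.
  by exists n; rewrite eqn_leq front_leq -{1}[n]minnn geq_minn_front.
(* The least index reaching [n] is a successor, because [front 0] is 0 while [n] is positive. *)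
case/ex_minnP => -[|H] /eqP eqH minH; first by rewrite -eqH in n_gt0.
exists H => //; rewrite ltn_neqAle front_leq andbT.
by apply/negP => /minH; rewrite ltnn.
Qed.

End Cut.

(** * Levels, length and good elements of the represented semiorder *)

Section SvecPoset.
Variables (n : nat) (r : svec n).
Local Notation P := (semiorder_of r).
Local Notation c := (cut n r).
Local Notation y := (front n r).
Implicit Types a b : P.
Let ix (a : P) : nat := nat_of_ord (a : 'I_n).
Local Notation rP := (svecP r).

Lemma svec_ltE a b : (a < b)%O = (c (ix b) <= ix a).
Proof.
rewrite lt_def -[(a <= b)%O]/((a == b) || svec_lt a b) eq_sym.
case: eqP => [-> /=|_] //; symmetry; apply: negbTE.
by rewrite -ltnNge; apply: ltn_cut rP _ (ltn_ord _).
Qed.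

Lemma svec_geq_lt a b b' : (a < b)%O -> ix b' <= ix b -> (a < b')%O.
Proof. by rewrite !svec_ltE => ab /(leq_cut rP) /leq_trans; apply. Qed.

Lemma svec_lt_geq a b a' : (a < b)%O -> ix a <= ix a' -> (a' < b)%O.
Proof. by rewrite !svec_ltE; apply: leq_trans. Qed.

Lemma svec_nth_card a : nth 0 r (ix a) = #|[set b | (b < a)%O]|.
Proof.
rewrite (eq_card (B := mem [set b : 'I_n | c (ix a) <= b])) => [|b].
  rewrite card_ord_geq /cut subKn //.
  by apply: leq_trans (svec_nth_leq rP _) (leq_subr _ _).
by rewrite !inE svec_ltE.
Qed.

(** Lowering the index of the larger element, or raising that of the smaller one, preserves [<]. In
    2+2, comparing the indices of the two tops puts one bottom below the other top; in 3+1,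
    comparing the middle of the chain with the isolated point makes that point comparable to an end
    of the chain. *)
Lemma svec_semiorder : is_semiorder P.
Proof.
have ltP p q (f : 'I_p + 'I_q -> P)
    (fP : forall u v, (f u <= f v)%O = chain_sum u v) u v :
    (f u < f v)%O = chain_sum u v && ~~ chain_sum v u.
  by rewrite lt_leAnge !fP.
split=> -[f /ltP ltf].
  pose a0 := f (inl (@Ordinal 2 0 isT)); pose a1 := f (inl (@Ordinal 2 1 isT)).
  pose b0 := f (inr (@Ordinal 2 0 isT)); pose b1 := f (inr (@Ordinal 2 1 isT)).
  have lt_a : (a0 < a1)%O by rewrite ltf.
  have lt_b : (b0 < b1)%O by rewrite ltf.
  case: (leqP (ix a1) (ix b1)) => [le_ab | /ltnW le_ba].
    by have := svec_geq_lt lt_b le_ab; rewrite ltf.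
  by have := svec_geq_lt lt_a le_ba; rewrite ltf.
pose a0 := f (inl (@Ordinal 3 0 isT)); pose a1 := f (inl (@Ordinal 3 1 isT)).
pose a2 := f (inl (@Ordinal 3 2 isT)); pose b := f (inr (@Ordinal 1 0 isT)).
have lt01 : (a0 < a1)%O by rewrite ltf.
have lt12 : (a1 < a2)%O by rewrite ltf.
case: (leqP (ix a1) (ix b)) => [le_ab | /ltnW le_ba].
  by have := svec_lt_geq lt12 le_ab; rewrite ltf.
by have := svec_geq_lt lt01 le_ba; rewrite ltf.
Qed.

(** Going down from index [p] leads to an index at least [cut p], and [cut] is monotone. *)
Lemma chain_front (s : seq P) a : sorted >%O (rcons s a) -> y (size s) <= ix a.
Proof.
elim/last_ind: s a => [|s b IHs] a //.
rewrite size_rcons -cats1 -cats1 -catA /= => sorted_sba.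
have [sorted_sb lt_ab] : sorted >%O (rcons s b) /\ (a < b)%O.
  rewrite -cats1; case: s sorted_sba {IHs} => /= [|d s]; first by case/andP.
  by rewrite !cat_path /= => /and4P[-> -> ->].
apply: leq_trans (leq_cut rP (IHs _ sorted_sb)) _.
by rewrite -svec_ltE.
Qed.

Lemma ltn_front_lt k k' a b :
  k < k' -> y k' <= ix a -> ix b = y k -> (a < b)%O.
Proof.
move=> lt_k le_a eq_b; rewrite svec_ltE eq_b -frontS.
exact: leq_trans (leq_front rP lt_k) le_a.
Qed.

(** The greedy chain: the elements of index [y 0], ..., [y k.-1], each the first of its level. *)
Lemma front_chain k a : y k <= ix a ->
  exists2 s : seq P, size s = k & sorted >%O (rcons s a).
Proof.
elim: k a => [|k IHk] a le_a; first by exists [::].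
have lt_k : y k < n.
  by apply: leq_ltn_trans (ltn_ord a); apply: leq_trans le_a; apply: front_leqS rP _.
have [s size_s sorted_s] := IHk (Ordinal lt_k : P) (leqnn _).
exists (rcons s (Ordinal lt_k : P)); first by rewrite size_rcons size_s.
have lt_a : (a < (Ordinal lt_k : P))%O by rewrite svec_ltE.
case: s sorted_s {size_s} => /= [|b s]; first by rewrite lt_a.
by move=> sorted_s; rewrite rcons_path sorted_s last_rcons.
Qed.

Lemma level_front k a : y k <= ix a < y k.+1 -> level a = k.+1.
Proof.
case/andP=> le_a lt_a; apply/eqP; rewrite eqn_leq; apply/andP; split.
  apply/bigmax_leqP => i /existsP[s /chain_front]; rewrite size_tuple => le_i.
  have := leq_ltn_trans le_i lt_a; apply: contraTT.
  by rewrite -!leqNgt => /(leq_front rP).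
(* The maximum defining [level] ranges over [k < #|P|], so the witness must respect this bound. *)
have lt_kn : k < n.
  by have := geq_minn_front rP k; have := ltn_ord a; rewrite /ix in le_a; lia.
have lt_kP : k < #|{: P}| by rewrite card_ord.
have [s /eqP size_s sorted_s] := front_chain le_a.
apply: (bigop.bigmax_sup (Ordinal lt_kP)) => //.
by apply/existsP; exists (Tuple size_s).
Qed.

Lemma level_exists H a : y H.+1 = n ->
  exists2 k, k < H.+1 & y k <= ix a < y k.+1.
Proof.
by move=> eq_n; apply: front_block; rewrite eq_n; apply: ltn_ord.
Qed.

(** Elements of one level are incomparable, so a chain injects into the [H.+1] levels; the first
    elements of the levels form a chain of that size. *)
Lemma svec_poset_length H : y H < n -> y H.+1 = n -> poset_length P = H.
Proof.
move=> lt_H eq_H; apply/eqP; rewrite eqn_leq; apply/andP; split.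
  apply/bigmax_leqP => A /forall_inP chainA.
  suff: #|A| <= H.+1 by lia.
  pose lv a : 'I_H.+1 := inord (level a).-1.
  rewrite -[X in _ <= X]card_ord -(card_in_imset (f := lv)) ?max_card // => a b aA bA.
  have [k le_k ka] := level_exists a eq_H.
  have [l le_l lb] := level_exists b eq_H.
  rewrite /lv (level_front ka) (level_front lb) /= => /(congr1 val).
  rewrite /= !inordK // => eq_kl; rewrite -eq_kl in lb.
  have incomp a' b' : y k <= ix a' < y k.+1 -> y k <= ix b' < y k.+1 -> ~~ (a' < b')%O.
    move=> /andP[_ lt_a'] /andP[/(leq_cut rP) le_b' _].
    by rewrite svec_ltE -ltnNge; apply: leq_trans le_b'.
  have /forall_inP/(_ b bA) := chainA a aA.
  case: comparableP => //; first by rewrite (negbTE (incomp _ _ ka lb)).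
  by rewrite (negbTE (incomp _ _ lb ka)).
have lt_y (i : 'I_H.+1) : y i < n.
  by apply: leq_ltn_trans lt_H; apply: leq_front rP _ _ _; rewrite -ltnS.
pose e (i : 'I_H.+1) : P := Ordinal (lt_y i).
have e_inj : injective e.
  move=> i j /(congr1 ix); rewrite -[ix (e i)]/(y i) -[ix (e j)]/(y j) => eq_ij.
  apply: val_inj; case: (ltngtP i j) => // /(ltn_front rP (lt_y _)).
    by rewrite eq_ij ltnn.
  by rewrite eq_ij ltnn.
rewrite -[H]/(H.+1.-1) -[H.+1]card_ord -(card_imset _ e_inj).
apply: (leq_bigmax_cond (F := fun A : {set P} => #|A|.-1)).
apply/forall_inP => _ /imsetP[i _ ->]; apply/forall_inP => _ /imsetP[j _ ->].
have lt_e (k l : 'I_H.+1) : k < l -> (e l < e k)%O.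
  by move=> lt_kl; apply: ltn_front_lt lt_kl _ _.
case: (ltngtP i j) => [/lt_e|/lt_e|/val_inj->].
- by rewrite /Order.comparable => /ltW->; rewrite orbT.
- by rewrite /Order.comparable => /ltW->.
- exact: comparablexx.
Qed.

Lemma svec_card_good H : y H < n -> y H.+1 = n -> #|good P| = n - y H.
Proof.
move=> lt_H eq_H; rewrite -card_ord_geq; apply: eq_card => a.
rewrite !inE (svec_poset_length lt_H eq_H).
have [k le_k ka] := level_exists a eq_H.
rewrite (level_front ka) eqSS; apply/eqP/idP => [<-|le_a]; first by case/andP: ka.
apply/eqP; rewrite eqn_leq -ltnS le_k /= leqNgt; apply/negP => /(leq_front rP) le_kH.
case/andP: ka => _ lt_a.
by have := leq_trans lt_a (leq_trans le_kH le_a); rewrite ltnn.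
Qed.

End SvecPoset.

(** * Isomorphism invariance of the length and of the vector *)

Lemma poset_iso_length (d d' : Order.disp_t) (P : finPOrderType d)
    (Q : finPOrderType d') : poset_iso P Q -> poset_length P = poset_length Q.
Proof.
have leP (d1 d2 : Order.disp_t) (P1 : finPOrderType d1) (P2 : finPOrderType d2)
    (f : P1 -> P2) : {mono f : x y / (x <= y)%O} ->
    poset_length P1 <= poset_length P2.
  move=> f_mono; apply/bigmax_leqP => A /forall_inP chainA.
  rewrite -(card_imset _ (inc_inj f_mono)).
  apply: (leq_bigmax_cond (F := fun A : {set P2} => #|A|.-1)).
  apply/forall_inP => _ /imsetP[x xA ->]; apply/forall_inP => _ /imsetP[z zA ->].
  by rewrite /Order.comparable !f_mono; have /forall_inP/(_ z zA) := chainA x xA.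
case=> f [g fK gK] f_mono; apply/eqP; rewrite eqn_leq (leP _ _ _ _ f) //=.
by apply: (leP _ _ _ _ g) => x z; rewrite -f_mono !gK.
Qed.

Lemma svec_iso_eq (n : nat) (r r' : svec n) :
  poset_iso (semiorder_of r) (semiorder_of r') -> svec_seq r = svec_seq r'.
Proof.
case=> f f_bij f_mono.
have seqE (q : svec n) : svec_seq q =
    map (fun a : semiorder_of q => #|[set b | (b < a)%O]|) (enum 'I_n).
  apply: (@eq_from_nth _ 0) => [|i].
    by rewrite size_map size_enum_ord (svec_size (svecP q)).
  rewrite (svec_size (svecP q)) => lt_in.
  rewrite (nth_map (Ordinal lt_in)) ?size_enum_ord // -svec_nth_card.
  by rewrite nth_enum_ord.
(* Both vectors are sorted, so it suffices that the down-set sizes agree up to permutation. *)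
apply: (sorted_eq geq_trans).
- by move=> a b; rewrite andbC => /anti_leq.
- by case/and3P: (svecP r).
- by case/and3P: (svecP r').
rewrite (seqE r) (seqE r'); have [g fK gK] := f_bij.
rewrite (eq_map (g := (fun a => #|[set b | (b < a)%O]|) \o f)) => [|a /=]; last first.
  rewrite -(card_imset _ (bij_inj f_bij)); apply: eq_card => b.
  rewrite -{1}[b]gK (mem_imset _ _ (bij_inj f_bij)) !inE -{2}[b]gK.
  by rewrite !lt_leAnge !f_mono.
rewrite map_comp; apply: perm_map; apply: uniq_perm.
- by rewrite map_inj_uniq ?enum_uniq //; apply: bij_inj.
- exact: enum_uniq.
move=> b; rewrite mem_enum; apply/mapP.
by exists (g b); rewrite ?mem_enum ?gK.
Qed.

(** * Nested down-sets and up-sets in a semiorder *)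

Section Weight.
Variables (d : Order.disp_t) (P : finPOrderType d).
Hypothesis P_semi : is_semiorder P.
Implicit Types a b x y z : P.

(** If both conclusions failed, [a < x] and [b < y] would form an induced 2+2: any further relation
    would compose with these two to give one of the excluded ones. *)
Lemma semiorder_22 a b x y : (a < x)%O -> (b < y)%O -> (a < y)%O \/ (b < x)%O.
Proof.
move=> ax byy; case: (boolP (a < y)%O) => [|nay]; first by left.
case: (boolP (b < x)%O) => [|nbx]; first by right.
case: P_semi => + _; case.
exists (fun u : 'I_2 + 'I_2 => match u with
  | inl i => if i == 0 :> nat then a else x
  | inr i => if i == 0 :> nat then b else y end).
have [nxa nyb] : (x <= a)%O = false /\ (y <= b)%O = false.
  by rewrite !lt_geF.
have nab : (a <= b)%O = false by apply: contraNF nay => /le_lt_trans; apply.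
have nba : (b <= a)%O = false by apply: contraNF nbx => /le_lt_trans; apply.
have nxy : (x <= y)%O = false by apply: contraNF nay; apply: lt_le_trans.
have nyx : (y <= x)%O = false by apply: contraNF nbx; apply: lt_le_trans.
(* Only the case [a = y] is new; there [b < a < x], against the failure of [b < x]. *)
have nay' : (a <= y)%O = false.
  rewrite le_eqVlt (negbTE nay) orbF; apply: contraNF nbx => /eqP eq_ay.
  by rewrite -eq_ay in byy; apply: lt_trans ax.
have nbx' : (b <= x)%O = false.
  rewrite le_eqVlt (negbTE nbx) orbF; apply: contraNF nay => /eqP eq_bx.
  by rewrite -eq_bx in ax; apply: lt_trans byy.
have nya : (y <= a)%O = false.
  by apply: contraNF nbx => /(lt_le_trans byy)/lt_trans; apply.
have nxb : (x <= b)%O = false.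
  by apply: contraNF nay => /(lt_le_trans ax)/lt_trans; apply.
by case=> -[[|[]] // ?] [] [[|[]] // ?] /=; rewrite ?lexx ?(ltW ax) ?(ltW byy).
Qed.

Lemma semiorder_31 a b c x : (a < b)%O -> (b < c)%O -> (a < x)%O \/ (x < c)%O.
Proof.
move=> ab bc; case: (boolP (a < x)%O) => [|nax]; first by left.
case: (boolP (x < c)%O) => [|nxc]; first by right.
case: P_semi => _; case; have ac := lt_trans ab bc.
exists (fun u : 'I_3 + 'I_1 => match u with
  | inl i => if i == 0 :> nat then a else if i == 1 :> nat then b else c
  | inr _ => x end).
have [nba ncb nca] : [/\ (b <= a)%O = false, (c <= b)%O = false & (c <= a)%O = false].
  by rewrite !lt_geF.
have nxa : (x <= a)%O = false by apply: contraNF nxc => /le_lt_trans; apply.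
have nbx : (b <= x)%O = false by apply: contraNF nax; apply: lt_le_trans.
have nxb : (x <= b)%O = false by apply: contraNF nxc => /le_lt_trans; apply.
have ncx : (c <= x)%O = false by apply: contraNF nax; apply: lt_le_trans.
have nax' : (a <= x)%O = false.
  rewrite le_eqVlt (negbTE nax) orbF; apply: contraNF nxc => /eqP <-; exact: ac.
have nxc' : (x <= c)%O = false.
  rewrite le_eqVlt (negbTE nxc) orbF; apply: contraNF nax => /eqP ->; exact: ac.
by case=> -[[|[|[]]] // ?] [] [[|[|[]]] // ?] /=;
  rewrite ?lexx ?(ltW ab) ?(ltW bc) ?(ltW ac).
Qed.

Definition down x := [set a | (a < x)%O].
Definition up x := [set z | (x < z)%O].

(* Descending weight sorts the down-sets decreasingly and, simultaneously,    *)
(* the up-sets increasingly.                                                  *)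
Definition weight x := #|down x| + #|~: up x|.

Lemma weight_lt x y : up y \subset up x -> down x \subset down y ->
  ~~ (up x \subset up y) || ~~ (down y \subset down x) -> weight x < weight y.
Proof.
move=> sub_u sub_d; rewrite /weight.
have := subset_leq_card sub_d.
have := subset_leq_card (etrans (setCS _ _) sub_u).
move=> le_u le_d /orP[nu|nd].
  suff: #|~: up x| < #|~: up y| by lia.
  by rewrite proper_card // properE !setCS sub_u nu.
suff: #|down x| < #|down y| by lia.
by rewrite proper_card // properE sub_d nd.
Qed.

(** Take [a] below [x] but not below [y]. Freeness from 2+2, applied to [a < x] and any [b < y],
    gives the first inclusion; freeness from 3+1, applied to [a < x < b] and [y], gives the
    second. *)
Lemma down_up_sub x y : ~~ (down x \subset down y) ->
  down y \subset down x /\ up x \subset up y.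
Proof.
case/subsetPn => a; rewrite !inE => ax nay; split; apply/subsetP => b.
  by rewrite !inE => byy; case: (semiorder_22 ax byy) => // /(negP nay).
by rewrite !inE => xb; case: (semiorder_31 y ax xb) => // /(negP nay).
Qed.

Lemma up_down_sub x y : ~~ (up x \subset up y) ->
  up y \subset up x /\ down x \subset down y.
Proof.
move=> nxy; split; last first.
  by apply: contraNT nxy => /down_up_sub[].
case/subsetPn: nxy => z; rewrite !inE => xz nyz; apply/subsetP => w.
by rewrite !inE => yw; case: (semiorder_22 xz yw) => // /(negP nyz).
Qed.

(** A failed inclusion forces the opposite inclusion of up-sets, strictly, together with the
    matching one of down-sets, and so a strict inequality of weights. *)
Lemma weight_up_sub x y : weight y <= weight x -> up x \subset up y.
Proof.
apply: contraTT => nu; have [sub_u sub_d] := up_down_sub nu.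
by rewrite -ltnNge weight_lt ?nu.
Qed.

Lemma weight_down_sub x y : weight y <= weight x -> down y \subset down x.
Proof.
apply: contraTT => nd; have [sub_d sub_u] := down_up_sub nd.
by rewrite -ltnNge weight_lt ?nd ?orbT.
Qed.

End Weight.

(** * Forests, their levels and their degrees *)

Definition degree (t : otree) := size (children t).
Definition next_level (f : seq otree) := flatten [seq children u | u <- f].

Lemma nodes_atE t i : nodes_at t i = iter i next_level [:: t].
Proof. by elim: i => //= i ->. Qed.

Lemma size_next_level f : size (next_level f) = sumn [seq degree u | u <- f].
Proof. by rewrite size_flatten /shape -map_comp. Qed.

(** The degrees are the shape of the list of child lists, and a flattened list is recovered from its
    shape. *)
Lemma degree_next_level_inj f f' :
  [seq degree u | u <- f] = [seq degree u | u <- f'] ->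
  next_level f = next_level f' -> f = f'.
Proof.
move=> eq_deg eq_next.
have : map children f = map children f'.
  rewrite -[LHS]flattenK -[RHS]flattenK -/(next_level f) -/(next_level f') eq_next.
  by rewrite /shape -!map_comp; congr reshape.
by apply: inj_map => -[ts] [ts'] /= ->.
Qed.

(** Built from the deepest level up: [reshape] groups the trees of the next level into child lists.
    Since [nth] defaults to the empty list, the hypothesis makes the last level consist of
    leaves. *)
Lemma forest_of_degrees (ds : seq (seq nat)) :
  (forall i, sumn (nth [::] ds i) = size (nth [::] ds i.+1)) ->
  exists f, forall i, [seq degree u | u <- iter i next_level f] = nth [::] ds i.
Proof.
elim: ds => [|d ds IHds] ds_sums.
  by exists [::] => i; rewrite nth_nil; elim: i => // i; rewrite iterSr.
have [f fP] := IHds (fun i => ds_sums i.+1).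
have size_f : size f = sumn d by rewrite (ds_sums 0) /= -(fP 0) size_map.
pose g := [seq ONode ts | ts <- reshape d f].
have g_level : next_level g = f.
  by rewrite /next_level -map_comp map_id reshapeKr // size_f.
exists g => -[|i] /=; last by rewrite -iterS iterSr g_level.
rewrite -map_comp -[map _ _]/(shape _) reshapeKl ?size_f //.
Qed.

Lemma num_nodes_forest f :
  sumn [seq num_nodes u | u <- f] = size f + sumn [seq num_nodes u | u <- next_level f].
Proof.
elim: f => //= -[ts] f IHf.
by rewrite /next_level /= map_cat sumn_cat IHf /next_level; lia.
Qed.

Lemma num_nodes_levels t k :
  num_nodes t = \sum_(0 <= i < k) tree_x t i +
                sumn [seq num_nodes u | u <- nodes_at t k].
Proof.
elim: k => [|k IHk]; first by rewrite big_geq //= addn0.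
by rewrite IHk big_nat_recr //= (num_nodes_forest (nodes_at t k)) addnA.
Qed.

(** The height of the tree obtained by placing a root above the forest, so that exactly the empty
    forest has height 0. *)
Definition forest_height f := foldr maxn 0 [seq (height u).+1 | u <- f].

Lemma forest_height_next_level f : forest_height (next_level f) = (forest_height f).-1.
Proof.
elim: f => //= -[ts] f IHf; rewrite /next_level /= /forest_height map_cat foldr_cat /=.
rewrite -/(forest_height f) -[foldr maxn 0 _]/(forest_height (next_level f)) IHf.
have -> s m : foldr maxn m s = maxn (foldr maxn 0 s) m.
  by elim: s => [|x s IHs] /=; rewrite ?max0n // IHs maxnA.
rewrite -/(forest_height ts).
lia.
Qed.

Lemma nodes_at_height t i : nilp (nodes_at t i) = (height t < i).
Proof.
have height_at : forest_height (nodes_at t i) = (height t).+1 - i.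
  rewrite nodes_atE; elim: i => [|i IHi]; first by rewrite /forest_height /= maxn0.
  by rewrite iterS forest_height_next_level IHi; lia.
have -> : nilp (nodes_at t i) = (forest_height (nodes_at t i) == 0).
  case: (nodes_at t i) => // u f; rewrite /nilp /forest_height /=; lia.
by rewrite height_at subn_eq0.
Qed.

(** * The vector of a tree in terms of breadth-first degrees *)

(** Breadth-first degrees at depths below [m]. The root is entry 0, so non-root node [p], counted
    from 0, is entry [p.+1], and [take p.+1] stops just before it. *)
Definition degrees t m :=
  flatten [seq [seq degree u | u <- nodes_at t i] | i <- iota 0 m].

Arguments degrees : simpl never.

Lemma degreesS t m :
  degrees t m.+1 = degrees t m ++ [seq degree u | u <- nodes_at t m].
Proof. by rewrite /degrees -addn1 iotaD map_cat flatten_cat /= cats0. Qed.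

Lemma tree_yS t i : tree_y t i.+1 = tree_y t i + tree_x t i.+1.
Proof. by rewrite /tree_y big_nat_recr. Qed.

Lemma tree_y0 t : tree_y t 0 = 0.
Proof. by rewrite /tree_y big_geq. Qed.

Lemma tree_x0 t : tree_x t 0 = 1. Proof. by []. Qed.

Lemma tree_xS t i : tree_x t i.+1 = sumn [seq degree u | u <- nodes_at t i].
Proof. by rewrite -size_next_level. Qed.

Lemma size_degrees t m : size (degrees t m.+1) = (tree_y t m).+1.
Proof.
elim: m => [|m IHm]; first by rewrite tree_y0.
by rewrite degreesS size_cat IHm size_map tree_yS.
Qed.

Lemma sumn_degrees t m : sumn (degrees t m) = tree_y t m.
Proof.
elim: m => [|m IHm]; first by rewrite tree_y0.
by rewrite degreesS sumn_cat IHm tree_yS tree_xS.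
Qed.

Lemma tree_uE t i j :
  tree_u t i.+1 j.+1 = sumn (drop j [seq degree u | u <- nodes_at t i]).
Proof.
rewrite sumn_drop_nth size_map /tree_u /= big_add1 /=.
rewrite big_nat_cond [RHS]big_nat_cond; apply: eq_bigr => k /andP[/andP[_ lt_k] _].
by rewrite (nth_map (ONode [::])).
Qed.

(** Entry [p] counts the non-root nodes that follow the children of the root and of the first [p]
    other nodes. The three blocks of the recursion match: older nodes gain the whole new level,
    nodes of the current last level gain the children from their own onward, and new nodes start at
    0. *)
Lemma tree_RE t h :
  tree_R t h = mkseq (fun p => tree_y t h.+1 - sumn (take p.+1 (degrees t h.+1)))
                     (tree_y t h.+1).
Proof.
have full_deg i p : tree_y t i <= p ->
    sumn (take p.+1 (degrees t i.+1)) = tree_y t i.+1.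
  by move=> le_p; rewrite take_oversize ?size_degrees // sumn_degrees.
elim: h => [|h IHh].
  have x1 : tree_x t 1 = tree_y t 1 by rewrite tree_yS tree_y0.
  rewrite [LHS]/= x1; apply: (@eq_from_nth _ 0) => [|p].
    by rewrite size_nseq size_mkseq.
  rewrite size_nseq => lt_p.
  by rewrite nth_nseq lt_p nth_mkseq // full_deg ?tree_y0 // subnn.
rewrite -[LHS]/(tree_R_step t h.+1 (tree_R t h)) /tree_R_step IHh /mkseq.
have iota1 m : iota 1 m = map succn (iota 0 m) by rewrite -[1]addn0 iotaDl.
have -> : iota 0 (tree_y t h.+2) = iota 0 (tree_y t h) ++
    iota (tree_y t h) (tree_x t h.+1) ++ iota (tree_y t h.+1) (tree_x t h.+2).
  by rewrite tree_yS iotaD {1}tree_yS iotaD -catA !add0n.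
rewrite !map_cat !iota1 -!map_comp.
congr (_ ++ _ ++ _).
- apply/eq_in_map => p; rewrite mem_iota add0n => /andP[_ lt_p].
  rewrite -[LHS]/(nth 0 _ p + tree_x t h.+2).
  have lt_p' : p < tree_y t h.+1 by rewrite tree_yS ltn_addr.
  rewrite nth_mkseq // (degreesS t h.+1) takel_cat; last first.
    by rewrite size_degrees ltnW.
  suff: sumn (take p.+1 (degrees t h.+1)) <= tree_y t h.+1.
    by rewrite (tree_yS t h.+1); lia.
  by rewrite -sumn_degrees -[X in _ <= sumn X](cat_take_drop p.+1) sumn_cat leq_addr.
- rewrite -[tree_y t h in RHS]addn0 iotaDl -map_comp.
  apply/eq_in_map => q; rewrite mem_iota add0n => /andP[_ lt_q].
  rewrite -[LHS]/(nth 0 _ (tree_y t h + q.+1).-1 + tree_u t h.+2 q.+1) addnS.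
  rewrite -[RHS]/(tree_y t h.+2 - sumn (take (tree_y t h + q).+1 (degrees t h.+2))).
  have lt_q' : tree_y t h + q < tree_y t h.+1 by rewrite tree_yS ltn_add2l.
  rewrite -[(tree_y t h + q).+1.-1]/(tree_y t h + q) nth_mkseq //.
  (* The nodes of depth [h.+1] have entry 0 in [tree_R t h], so only the new term [tree_u]
     remains. *)
  rewrite full_deg ?leq_addr // subnn add0n.
  rewrite tree_uE (degreesS t h.+1) -addSn -size_degrees takeD.
  rewrite take_size_cat // drop_size_cat //.
  rewrite sumn_cat sumn_degrees (tree_yS t h.+1) tree_xS.
  by rewrite -{2}[map _ _](cat_take_drop q) sumn_cat; lia.
apply: (@eq_from_nth _ 0) => [|p]; first by rewrite size_nseq size_map size_iota.
rewrite size_nseq => lt_p; rewrite nth_nseq lt_p (nth_map 0) ?size_iota // nth_iota //.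
by rewrite full_deg ?subnn ?leq_addr.
Qed.

Lemma take_degrees t i m : i <= m ->
  take (tree_y t i).+1 (degrees t m.+1) = degrees t i.+1.
Proof.
move=> le_im; rewrite -(subnK le_im); elim: (m - i) => [|k IHk].
  by rewrite add0n -size_degrees take_size.
rewrite addSn degreesS takel_cat ?IHk // -size_degrees -{1}IHk size_take_min.
exact: geq_minr.
Qed.

Lemma num_nodes_tree_y t : num_nodes t = (tree_y t (height t)).+1.
Proof.
rewrite (num_nodes_levels t (height t).+1).
have /nilP -> : nilp (nodes_at t (height t).+1) by rewrite nodes_at_height.
by rewrite /= addn0 big_ltn // tree_x0 add1n.
Qed.

Lemma tree_x_gt0 t i : (0 < tree_x t i) = (i <= height t).
Proof. by rewrite lt0n -[tree_x t i == 0]/(nilp _) nodes_at_height -leqNgt. Qed.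

Section TreeVector.
Variables (t : otree) (H : nat).
Local Notation n := (tree_y t H.+1).
Local Notation cs p := (sumn (take p.+1 (degrees t H.+1))).

Lemma sumn_take_degrees_leq p : cs p <= n.
Proof.
by rewrite -[X in _ <= X]sumn_degrees -[X in _ <= sumn X](cat_take_drop p.+1)
  sumn_cat leq_addr.
Qed.

Lemma leq_sumn_take p q : p <= q -> cs p <= cs q.
Proof.
move=> le_pq; rewrite -(subnKC le_pq) -addSn takeD sumn_cat; exact: leq_addr.
Qed.

Lemma tree_cut p : cut n (tree_R t H) p = cs p.
Proof.
rewrite /cut tree_RE; case: (ltnP p n) => [lt_p | le_p].
  by rewrite nth_mkseq // subKn // sumn_take_degrees_leq.
rewrite nth_default ?size_mkseq // subn0 take_oversize ?sumn_degrees //.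
by rewrite size_degrees ltnS (leq_trans _ le_p) // tree_yS leq_addr.
Qed.

(** The children of the nodes of depth at most [i] are the non-root nodes of depth at most
    [i.+1]. *)
Lemma tree_cut_y i : i <= H -> cs (tree_y t i) = tree_y t i.+1.
Proof. by move=> le_i; rewrite take_degrees // sumn_degrees. Qed.

Lemma tree_front i : i <= H.+1 -> front n (tree_R t H) i = tree_y t i.
Proof.
elim: i => [|i IHi] le_i; first by rewrite tree_y0.
by rewrite frontS IHi 1?ltnW // tree_cut tree_cut_y.
Qed.

Lemma tree_svec : is_svec n (tree_R t H).
Proof.
(* A node is listed as a child before its own children are counted: if
   [tree_y t i <= p < tree_y t i.+1], the prefix sum at [p] is already at least [tree_y t i.+1]. *)
have lt_cs i p : i <= H.+1 -> p < tree_y t i -> p < cs p.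
  elim: i => [|i IHi] le_i; first by rewrite tree_y0.
  move=> lt_p; case: (ltnP p (tree_y t i)) => [|/leq_sumn_take].
    exact: IHi (ltnW le_i).
  by rewrite tree_cut_y //; apply: leq_trans.
rewrite /is_svec tree_RE size_mkseq eqxx /=; apply/andP; split.
  apply/(sortedP 0) => i; rewrite size_mkseq => lt_i.
  by rewrite !nth_mkseq ?(ltnW lt_i) //= leq_sub2l // leq_sumn_take.
apply/forallP => i; rewrite nth_mkseq ?ltn_ord //.
by apply: leq_sub2l; apply: lt_cs (leqnn _) _.
Qed.

End TreeVector.

(** * Recovering the tree from the vector *)

Lemma tree_R_inj t t' H :
  height t = H.+1 -> height t' = H.+1 -> num_nodes t = num_nodes t' ->
  tree_R t H = tree_R t' H -> t = t'.
Proof.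
move=> ht ht' eq_num eqR.
have eq_n : tree_y t H.+1 = tree_y t' H.+1.
  by move: eq_num; rewrite !num_nodes_tree_y ht ht' => -[].
have eq_y i : i <= H.+1 -> tree_y t i = tree_y t' i.
  by move=> le_i; rewrite -(tree_front t le_i) -(tree_front t' le_i) eqR eq_n.
have eq_x i : i <= H.+1 -> tree_x t i = tree_x t' i.
  case: i => // i le_i; have := eq_y _ le_i.
  by rewrite !tree_yS (eq_y i (ltnW le_i)) => /addnI.
have eq_deg : degrees t H.+1 = degrees t' H.+1.
  apply: eq_sumn_take => [|p _]; first by rewrite !size_degrees eq_y.
  by rewrite -!tree_cut eqR eq_n.
have eq_level i : i <= H -> [seq degree u | u <- nodes_at t i] =
    [seq degree u | u <- nodes_at t' i].
  (* Equal level sizes let the common degree sequence be cut into levels in the same way for both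
     trees. *)
  move=> le_i; have := eq_from_flatten_shape eq_deg.
  have shapeE s : shape [seq [seq degree u | u <- nodes_at s i] | i <- iota 0 H.+1] =
      [seq tree_x s i | i <- iota 0 H.+1].
    by rewrite /shape -map_comp; apply: eq_map => k /=; rewrite size_map.
  rewrite !shapeE => eq_seq.
  have {}eq_seq := eq_seq _; have := congr1 (fun s => nth [::] s i) (eq_seq _).
  rewrite !(nth_map 0) ?size_iota // !nth_iota //; apply.
  by apply/eq_in_map => k; rewrite mem_iota => /andP[_ lt_k]; apply/eq_x/ltnW.
(* [degrees t H.+1] stops at depth [H]; the nodes of depth [H.+1] are leaves. *)
have last_level s : height s = H.+1 -> [seq degree u | u <- nodes_at s H.+1] =
    nseq (tree_x s H.+1) 0.
  move=> hs; have : nilp (nodes_at s H.+2) by rewrite nodes_at_height hs.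
  rewrite /nilp -[size _]/(tree_x s H.+2) tree_xS.
  rewrite /tree_x; elim: (nodes_at s H.+1) => //= u f IHf.
  by rewrite addn_eq0 => /andP[/eqP-> /IHf->].
(* Induction from the empty level [H.+2] up to the root. *)
suff eq_nodes k i : i + k = H.+2 -> nodes_at t i = nodes_at t' i.
  by have [] := eq_nodes H.+2 0 erefl.
elim: k i => [|k IHk] i eq_ik.
  rewrite addn0 in eq_ik.
  have /nilP -> : nilp (nodes_at t i) by rewrite nodes_at_height ht eq_ik.
  by have /nilP -> : nilp (nodes_at t' i) by rewrite nodes_at_height ht' eq_ik.
apply: degree_next_level_inj; last by apply: (IHk i.+1); rewrite addSnnS.
case: (leqP i H) => [/eq_level // | lt_i].
have -> : i = H.+1 by lia.
by rewrite !last_level ?eq_x.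
Qed.

Lemma svec_seq_inj n : injective (@svec_seq n).
Proof.
by move=> [r r_svec] [r' r'_svec] /= eq_r; case: _ / eq_r r'_svec => r'_svec;
  congr SVec; apply: bool_irrelevance.
Qed.

Lemma tree_of_svec (n H : nat) (r : seq nat) :
  is_svec n r -> front n r H < n -> front n r H.+1 = n ->
  exists t, [/\ num_nodes t = n.+1, height t = H.+1 & tree_R t H = r].
Proof.
move=> r_svec lt_H eq_H.
pose y := front n r; pose c := cut n r.
(* With the root counted as node 0, [C p] is to be the sum of the first [p] degrees, [Y i] the
   number of nodes of depth below [i], and [d p] the degree of node [p]. *)
pose C p := if p is p'.+1 then c p' else 0.
pose Y i := if i is i'.+1 then (y i').+1 else 0.
pose d p := C p.+1 - C p.
have C_mono p q : p <= q -> C p <= C q.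
  by case: p => // p; case: q => // q le_pq; rewrite /C leq_cut.
have Y_leqS i : Y i <= Y i.+1 by case: i => // i; apply: front_leqS r_svec _.
have CY i : C (Y i) = (Y i.+1).-1 by case: i.
have Y_max i : H.+2 <= i -> Y i = n.+1.
  case: i => // i le_i; congr S; apply/eqP; rewrite eqn_leq front_leq -{1}eq_H.
  exact: leq_front.
have sum_d a k : sumn [seq d p | p <- iota a k] = C (a + k) - C a.
  elim: k a => [|k IHk] a /=; first by rewrite addn0 subnn.
  rewrite IHk addSnnS /d.
  have := C_mono a a.+1 (leqnSn a); have := C_mono a.+1 (a + k.+1) _; lia.
pose ds i := [seq d p | p <- iota (Y i) (Y i.+1 - Y i)].
(* No node lies deeper than [H.+1], so the default value of [nth] agrees with the empty levels. *)
have nth_ds i : nth [::] (mkseq ds H.+2) i = ds i.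
  case: (ltnP i H.+2) => [lt_i | le_i]; first by rewrite nth_mkseq.
  by rewrite nth_default ?size_mkseq // /ds !Y_max ?subnn // ltnW.
have [f fP] : exists f, forall i, [seq degree u | u <- iter i next_level f] = ds i.
  have [|f fP] := @forest_of_degrees (mkseq ds H.+2) _; last first.
    by exists f => i; rewrite fP.
  move=> i; rewrite !nth_ds sum_d subnKC // !CY !size_map size_iota.
  have := Y_leqS i.+1; have : 0 < Y i.+1 by []. 
  lia.
have [t eq_f] : exists t, f = [:: t].
  have := congr1 size (fP 0); rewrite !size_map size_iota /=.
  by case: f {fP} => [|t []] // _; exists t.
exists t; rewrite {f}eq_f in fP.
have {}fP i : [seq degree u | u <- nodes_at t i] = ds i by rewrite nodes_atE.
have tx i : tree_x t i = Y i.+1 - Y i.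
  by have := congr1 size (fP i); rewrite !size_map size_iota.
have ty i : tree_y t i = y i.
  elim: i => [|i IHi]; first by rewrite tree_y0.
  by rewrite tree_yS IHi tx subSS subnKC //; apply: front_leqS r_svec _.
have ht : height t = H.+1.
  apply/eqP; rewrite eqn_leq -tree_x_gt0 tx subn_gt0 /Y /y ltnS eq_H.
  by rewrite lt_H andbT leqNgt -[_ < _]tree_x_gt0 tx !Y_max ?subnn.
have deg m : degrees t m = [seq d p | p <- iota 0 (Y m)].
  elim: m => // m IHm; rewrite degreesS IHm fP -map_cat.
  by rewrite -[X in iota X _]add0n -iotaD subnKC.
split=> //; first by rewrite num_nodes_tree_y ht ty /y eq_H.
have n_y : n = tree_y t H.+1 by rewrite ty /y eq_H.
have size_R : size (tree_R t H) = n by rewrite tree_RE size_mkseq -n_y.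
apply: (@eq_from_nth _ 0) => [|p _]; first by rewrite size_R (svec_size r_svec).
(* From [p = front n r H] on, the degrees are exhausted and both cuts equal [n]. *)
have cutP : cut n (tree_R t H) p = cut n r p.
  rewrite {1}n_y tree_cut deg -map_take take_iota sum_d subn0 add0n.
  rewrite /minn; case: ltnP => // le_Y; rewrite CY -[_.-1]/(front n r H.+1) eq_H.
  apply/eqP; rewrite eq_sym eqn_leq cut_leq -{1}eq_H frontS leq_cut //.
(* [cut] is a truncated subtraction, so recovering the entries from it requires that they be at most
   [n]. *)
have := svec_nth_leq r_svec p.
have := svec_nth_leq (tree_svec t H) p; rewrite -n_y.
by move: cutP; rewrite /cut; lia.
Qed.

(** * From semiorders to vectors, and the bijection *)

Lemma semiorder_svec (d : Order.disp_t) (P : finPOrderType d) :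
  is_semiorder P -> exists r : svec #|{: P}|, poset_iso (semiorder_of r) P.
Proof.
move=> P_semi; set n := #|{: P}|.
(* The enumeration below uses [nth], hence a default element; the empty poset is treated apart. *)
have [n0 | n_gt0] := posnP n.
  have r0 : is_svec n [::] by rewrite /is_svec n0; apply/forallP => -[].
  have no_ord (i : semiorder_of (SVec r0)) : False.
    by case: (i : 'I_n) => m; rewrite n0.
  have noP (x : P) : False.
    by have := card0_eq n0 x.
  exists (SVec r0), (fun i => False_rect _ (no_ord i)) => [|i]; last by case: (no_ord i).
  by exists (fun x => False_rect _ (noP x)) => x; [case: (no_ord x)|case: (noP x)].
have [x0 _] : exists x0 : P, x0 \in P by apply/card_gt0P.
pose leW (x y : P) := weight y <= weight x.
pose s := sort leW (enum P).
have size_s : size s = n by rewrite size_sort -cardE.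
have uniq_s : uniq s by rewrite sort_uniq enum_uniq.
have sorted_s : sorted leW s by apply: sort_sorted => x y; apply: leq_total.
pose e (i : 'I_n) := nth x0 s i.
have e_inj : injective e.
  by move=> i j /eqP; rewrite nth_uniq ?size_s // => /eqP/val_inj.
have e_bij : bijective e by apply: inj_card_bij e_inj _; rewrite card_ord.
have e_weight (i j : 'I_n) : i <= j -> weight (e j) <= weight (e i).
  apply: (sorted_leq_nth _ _ x0 sorted_s); rewrite ?inE ?size_s //.
    by move=> x y z yx xz; apply: leq_trans xz yx.
  by move=> x; apply: leqnn.
pose D i := [set j | (e j < e i)%O].
have cardD i : #|D i| = #|down (e i)|.
  rewrite -(card_imset _ e_inj); apply: eq_card => x; have [g eK gK] := e_bij.
  by rewrite -[x]gK (mem_imset _ _ e_inj) !inE.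
(* Up-sets grow along the list, so whatever follows an element below [e i] is also below [e i]. *)
have DP (i j : 'I_n) : (e j < e i)%O = (n - #|D i| <= j).
  rewrite -mem_up_closed ?inE // => j1 j2; rewrite !inE => lt_ji le_j.
  have /subsetP/(_ (e i)) := weight_up_sub P_semi (e_weight _ _ le_j).
  by rewrite !inE; apply.
pose r := [seq #|D i| | i <- enum 'I_n].
have nth_r (i : 'I_n) : nth 0 r i = #|D i|.
  by rewrite (nth_map i) ?size_enum_ord // nth_ord_enum.
have r_svec : is_svec n r.
  apply/and3P; split; first by rewrite size_map size_enum_ord.
    apply/(sortedP 0) => i; rewrite size_map size_enum_ord => lt_i.
    rewrite -[i]/(val (Ordinal (ltnW lt_i))) nth_r -[i.+1]/(val (Ordinal lt_i)) nth_r.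
    rewrite !cardD /=; apply: subset_leq_card; apply: weight_down_sub => //.
    exact: e_weight.
  apply/forallP => i; rewrite nth_r.
  have := DP i i; rewrite ltxx => /esym/negbT; rewrite -ltnNge.
  by have := ltn_ord i; lia.
exists (SVec r_svec), e => // i j.
by rewrite le_eqVlt (inj_eq e_inj) DP -nth_r.
Qed.

Theorem theorem2p7 (n H : nat) (n_ge1 : 1 <= n) :
  exists F : otree_of n H -> svec n,
    [/\ forall t : otree_of n H, svec_seq (F t) = tree_R (val t) H,
        forall t : otree_of n H,
          [/\ is_semiorder (semiorder_of (F t)),
              #|{: semiorder_of (F t)}| = n,
              poset_length (semiorder_of (F t)) = H
            & #|good (semiorder_of (F t))| = tree_x (val t) H.+1],
        forall t t' : otree_of n H,
          poset_iso (semiorder_of (F t)) (semiorder_of (F t')) -> t = t'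
      & forall (d : Order.disp_t) (P : finPOrderType d),
          is_semiorder P -> #|{: P}| = n -> poset_length P = H ->
          exists t : otree_of n H, poset_iso (semiorder_of (F t)) P].
Proof.
have treeP (t : otree_of n H) : height (val t) = H.+1 /\ tree_y (val t) H.+1 = n.
  by case: t => t /= /andP[/eqP + /eqP ht]; rewrite num_nodes_tree_y ht => -[].
have R_svec (t : otree_of n H) : is_svec n (tree_R (val t) H).
  by have [_ {1}<-] := treeP t; apply: tree_svec.
exists (fun t => SVec (R_svec t)); split=> //.
- move=> t; have [ht y_n] := treeP t.
  have frontE i : i <= H.+1 -> front n (tree_R (val t) H) i = tree_y (val t) i.
    by move=> le_i; rewrite -{1}y_n tree_front.
  have x_gt0 : 0 < tree_x (val t) H.+1 by rewrite tree_x_gt0 ht.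
  have n_yx : n = tree_y (val t) H + tree_x (val t) H.+1 by rewrite -tree_yS.
  have lt_H : front n (SVec (R_svec t)) H < n by rewrite frontE //; lia.
  have eq_H : front n (SVec (R_svec t)) H.+1 = n by rewrite [LHS]frontE.
  split; first exact: svec_semiorder.
  + exact: card_ord.
  + exact: svec_poset_length.
  + by rewrite (svec_card_good lt_H eq_H) frontE // {1}n_yx addKn.
- move=> t t' /svec_iso_eq /= eqR; apply: val_inj.
  have [ht y_n] := treeP t; have [ht' y_n'] := treeP t'.
  apply: tree_R_inj eqR => //.
  by rewrite !num_nodes_tree_y ht ht' y_n y_n'.
move=> d P P_semi cardP lenP.
have [r0 iso_r0] := semiorder_svec P_semi; rewrite {}cardP in r0 iso_r0.
(* The fronts of [r0] determine its length [H'], and isomorphism invariance identifies it with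
   [H]. *)
have [H' lt_H' eq_H'] := front_reach (svecP r0) n_ge1.
have eq_HH : H' = H.
  by rewrite -(svec_poset_length lt_H' eq_H') (poset_iso_length iso_r0).
rewrite {}eq_HH in lt_H' eq_H'.
have [t [num_t ht Rt]] := tree_of_svec (svecP r0) lt_H' eq_H'.
have tP : (num_nodes t == n.+1) && (height t == H.+1) by rewrite num_t ht !eqxx.
exists (exist _ t tP).
by have -> : SVec (R_svec (exist _ t tP)) = r0 by apply: svec_seq_inj.
Qed.
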